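(* Let $s,t\in\mathbb{C}$ with $t\neq 0$ and $0<|q|<1$, where $q=\varphi_{s,t}'/\varphi_{s,t}$, and let $u\in\mathbb{C}$. Then, as formal power series in $x$ (hence also as an identity of sums for every $x\in\mathbb{C}$ for which the series converge), $$\sum_{n=1}^{\infty}\genfrac{[}{]}{0pt}{}{2n}{n}_{q}\frac{(1-q^{n})(-u/t)^{\binom{n}{2}}}{(-\sqrt{q};q)_{n}(-q;q)_{n}}\left(\frac{4x}{\sqrt{-t\varphi_{s,t}}}\right)^n=\frac{4(1-\sqrt{q})x}{\sqrt{-t\varphi_{s,t}}}\;{}_{1}\Phi_{0}\left(\begin{array}{c} q\sqrt{q} \\ - \end{array};q,-\frac{u}{t},\frac{-4ux}{t\sqrt{-t\varphi_{s,t}}}\right).$$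
   Context: $\varphi_{s,t}=\frac{s+\sqrt{s^2+4t}}{2}$ and $\varphi_{s,t}'=\frac{s-\sqrt{s^2+4t}}{2}$ (for a fixed choice of the square root), so that $\varphi_{s,t}\varphi_{s,t}'=-t$; $q=\varphi_{s,t}'/\varphi_{s,t}$. Square roots $\sqrt q$ and $\sqrt{-t\varphi_{s,t}}$ are fixed once and for all. $(a;q)_0=1$ and $(a;q)_n=\prod_{k=0}^{n-1}(1-aq^k)$ for $n\ge1$; $(a_1,\dots,a_m;q)_n=(a_1;q)_n\cdots(a_m;q)_n$. The $q$-binomial coefficient is $\genfrac{[}{]}{0pt}{}{n}{k}_{q}=\frac{(q;q)_n}{(q;q)_k(q;q)_{n-k}}$. The deformed basic hypergeometric series is ${}_{r}\Phi_{r'}\left(\begin{array}{c} a_1,\ldots,a_r \\ b_1,\ldots,b_{r'} \end{array};q,v,z\right)=\sum_{n\ge0}v^{\binom n2}\frac{(a_1,\ldots,a_r;q)_n}{(q,b_1,\ldots,b_{r'};q)_n}\bigl[(-1)^nq^{\binom n2}\bigr]^{1+r'-r}z^n$; in particular ${}_{1}\Phi_{0}\left(\begin{array}{c} a \\ - \end{array};q,v,z\right)=\sum_{n\ge0}v^{\binom n2}\frac{(a;q)_n}{(q;q)_n}z^n$. Convention: $0^0=1$. *)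

(* Defs.v *)
From HB Require Import structures.
From mathcomp Require Import all_boot all_order all_algebra.
From mathcomp Require Import all_classical all_reals all_analysis.
From mathcomp Require Import complex.

Set Implicit Arguments.
Unset Strict Implicit.
Unset Printing Implicit Defensive.

Import Order.TTheory GRing.Theory Num.Theory.
Import numFieldNormedType.Exports.

Local Open Scope classical_set_scope.
Local Open Scope ring_scope.

(* Naming R[i] through this constant, of type numClosedFieldType, is what lets
   it inherit the topology that MathComp-Analysis puts on every numFieldType. *)
Definition Cplx (R : realType) : numClosedFieldType := R[i].

Section Fps.
Variable K : comNzRingType.

(* A record rather than [nat -> K], whose library ring structure is pointwise. *)
Record fps : Type := Fps { fps_coef : nat -> K }.

Lemma fpsP (f g : fps) : (forall n, fps_coef f n = fps_coef g n) <-> f = g.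
Proof.
split=> [|-> //]; case: f g => [f] [g] /= fg; congr Fps; exact/funext.
Qed.

HB.instance Definition _ := gen_eqMixin fps.
HB.instance Definition _ := gen_choiceMixin fps.

Definition fps_add (f g : fps) := Fps (fun n => fps_coef f n + fps_coef g n).
Definition fps_opp (f : fps) := Fps (fun n => - fps_coef f n).
Definition fpsC (c : K) := Fps (fun n => if n == 0%N then c else 0).
Definition fps_mul (f g : fps) :=
  Fps (fun n => \sum_(k < n.+1) fps_coef f k * fps_coef g (n - k)).
Definition fps_scale (c : K) (f : fps) := Fps (fun n => c * fps_coef f n).

Fact fps_addA : associative fps_add.
Proof. by move=> f g h; apply/fpsP => n /=; rewrite addrA. Qed.
Fact fps_addC : commutative fps_add.
Proof. by move=> f g; apply/fpsP => n /=; rewrite addrC. Qed.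
Fact fps_add0 : left_id (fpsC 0) fps_add.
Proof. by move=> f; apply/fpsP => n /=; rewrite if_same add0r. Qed.
Fact fps_addN : left_inverse (fpsC 0) fps_opp fps_add.
Proof. by move=> f; apply/fpsP => n /=; rewrite if_same addNr. Qed.

HB.instance Definition _ :=
  GRing.isZmodule.Build fps fps_addA fps_addC fps_add0 fps_addN.

Let trunc N (f : fps) : {poly K} := \poly_(i < N) fps_coef f i.

Let coef_fps_mul N f g n : (n < N)%N ->
  fps_coef (fps_mul f g) n = (trunc N f * trunc N g)`_n.
Proof.
move=> nN; rewrite coefM /=; apply: eq_bigr => k _; rewrite !coef_poly.
by rewrite (leq_ltn_trans _ nN) ?leq_ord // (leq_ltn_trans (leq_subr _ _)).
Qed.

Fact fps_mulC : commutative fps_mul.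
Proof.
by move=> f g; apply/fpsP => n; rewrite !(@coef_fps_mul n.+1) // mulrC.
Qed.

Fact fps_mulA : associative fps_mul.
Proof.
move=> f g h; apply/fpsP => n /=.
transitivity ((trunc n.+1 f * (trunc n.+1 g * trunc n.+1 h))`_n).
  rewrite coefM; apply: eq_bigr => k _.
  by rewrite -(@coef_fps_mul n.+1) ?ltnS ?leq_subr // coef_poly ltn_ord.
rewrite mulrA coefM; apply: eq_bigr => k _.
by rewrite -(@coef_fps_mul n.+1) // coef_poly ltnS leq_subr.
Qed.

Fact fps_mul1 : left_id (fpsC 1) fps_mul.
Proof.
move=> f; apply/fpsP => n /=.
by rewrite big_ord_recl big1 ?addr0 /= ?subn0 ?mul1r // => i _; rewrite mul0r.
Qed.

Fact fps_mulD : left_distributive fps_mul fps_add.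
Proof.
move=> f g h; apply/fpsP => n /=; rewrite -big_split /=.
by apply: eq_bigr => k _; rewrite mulrDl.
Qed.

Fact fps_1_neq0 : fpsC 1 != 0.
Proof.
apply/eqP => /(congr1 (fun f => fps_coef f 0)) /= /eqP.
by rewrite oner_eq0.
Qed.

HB.instance Definition _ := GRing.Zmodule_isComNzRing.Build fps
  fps_mulA fps_mulC fps_mul1 fps_mulD fps_1_neq0.

Fact fps_scaleA a b f : fps_scale a (fps_scale b f) = fps_scale (a * b) f.
Proof. by apply/fpsP => n /=; rewrite mulrA. Qed.
Fact fps_scale1 : left_id 1 fps_scale.
Proof. by move=> f; apply/fpsP => n /=; rewrite mul1r. Qed.
Fact fps_scaleDr : right_distributive fps_scale +%R.
Proof. by move=> a f g; apply/fpsP => n /=; rewrite mulrDr. Qed.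
Fact fps_scaleDl f : {morph fps_scale^~ f : a b / a + b}.
Proof. by move=> a b; apply/fpsP => n /=; rewrite mulrDl. Qed.

HB.instance Definition _ := GRing.Zmodule_isLmodule.Build K fps
  fps_scaleA fps_scale1 fps_scaleDr fps_scaleDl.

Fact fps_scaleAl (a : K) (f g : fps) : a *: (f * g) = a *: f * g.
Proof.
by apply/fpsP => n /=; rewrite mulr_sumr; apply: eq_bigr => k _; rewrite mulrA.
Qed.

HB.instance Definition _ := GRing.Lmodule_isLalgebra.Build K fps fps_scaleAl.
HB.instance Definition _ := GRing.Lalgebra_isComAlgebra.Build K fps.

Definition fpsX : fps := Fps (fun n => (n == 1%N)%:R).

(* The X-adic sum F m + F m.+1 + ... of a family in which F k has order at
   least k; fps_sumP justifies the truncation. *)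
Definition fps_sum (m : nat) (F : nat -> fps) : fps :=
  Fps (fun n => \sum_(m <= k < n.+1) fps_coef (F k) n).

Lemma fps_coef_sum m N (F : nat -> fps) n :
  fps_coef (\sum_(m <= k < N) F k) n = \sum_(m <= k < N) fps_coef (F k) n.
Proof.
apply: (big_morph (fun f => fps_coef f n)) => [//|].
by rewrite /= if_same.
Qed.

Lemma fps_sumP m (F : nat -> fps) :
  (forall k n, (n < k)%N -> fps_coef (F k) n = 0) ->
  forall n N, (n < N)%N ->
  fps_coef (\sum_(m <= k < N) F k) n = fps_coef (fps_sum m F) n.
Proof.
move=> ordF n N nN; rewrite fps_coef_sum /=.
have [mn|nm] := leqP m n.+1; last first.
  rewrite (big_geq (ltnW nm)) big_nat big1 // => k /andP[mk _].
  by rewrite ordF // (leq_trans _ mk) // ltnW.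
rewrite (big_cat_nat mn nN) /= [X in _ + X]big_nat [X in _ + X]big1 ?addr0 //.
by move=> k /andP[nk _]; rewrite ordF.
Qed.

End Fps.

Arguments fpsX {K}.

Section QSeries.
Variable K : fieldType.
Implicit Types (a q v z : K) (n k : nat).

Definition qpoch a q n : K := \prod_(k < n) (1 - a * q ^+ k).

Definition qbinom q n k : K :=
  qpoch q q n / (qpoch q q k * qpoch q q (n - k)).

(* The exponent 1 + r' - r is an integer and may be negative. *)
Definition dbhs_coef (al bl : seq K) (q v : K) (n : nat) : K :=
  v ^+ 'C(n, 2)
  * (\prod_(a <- al) qpoch a q n / \prod_(b <- q :: bl) qpoch b q n)
  * ((-1) ^+ n * q ^+ 'C(n, 2)) ^ (1 + (size bl)%:Z - (size al)%:Z).

(* Meaningful only for z with zero constant coefficient. *)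
Definition fps_dbhs (al bl : seq K) (q v : K) (z : fps K) : fps K :=
  fps_sum 0 (fun n => dbhs_coef al bl q v n *: z ^+ n).

End QSeries.

Section Analytic.
Variable R : realType.
Notation C := (Cplx R).

Definition dbhs_psum (al bl : seq C) (q v z : C) : C ^nat :=
  fun N => \sum_(0 <= n < N) dbhs_coef al bl q v n * z ^+ n.

Definition dbhs (al bl : seq C) (q v z : C) : C :=
  limn (dbhs_psum al bl q v z).

(* d is the chosen square root of s^2 + 4t. *)
Definition phi (s d : C) : C := (s + d) / 2.
Definition phi' (s d : C) : C := (s - d) / 2.

End Analytic.

(* Main.v *)
Require Import Defs.
From mathcomp Require Import all_boot all_order all_algebra.
From mathcomp Require Import all_classical all_reals all_analysis.
From mathcomp Require Import ring.
Import Order.TTheory GRing.Theory Num.Theory.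
Import numFieldNormedType.Exports.
Local Open Scope classical_set_scope.
Local Open Scope ring_scope.

(** Write v = -u/t and y = 4x/w. Splitting the factors of (q;q)_(2n) by the
    parity of the exponent, and each of them as a difference of squares, gives
      (q;q)_(2n) = (sq;q)_n (-sq;q)_n (q;q)_n (-q;q)_n    with sq^2 = q
    ([qpoch_double]). The denominator (-sq;q)_n (-q;q)_n therefore turns the
    central q-binomial coefficient into (sq;q)_n / (q;q)_n, the factor 1 - q^n
    lowers (q;q)_n to (q;q)_(n-1), and (sq;q)_n = (1 - sq) (q sq;q)_(n-1).
    Since binom(n+1,2) = binom(n,2) + n, the coefficient of y^(n+1) on the left
    is (1 - sq) v^n times the n-th coefficient of the series 1Phi0
    ([central_term_dbhs]). Both claims follow from this termwise identity.
    For formal power series, multiplying by the monomial (1 - sq) y moves every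
    coefficient of the series 1Phi0 at v y up by one degree
    ([fps_coefZXM]). For complex x, the sum over 1 <= n < N + 1 on the left is
    (1 - sq) y times the sum over 0 <= n < N in 1Phi0, and N tends to infinity
    ([lim_shift_scale]). The hypothesis |q| < 1 makes the q-Pochhammer
    denominators nonzero ([qpoch_neq0]). *)

Section QPochhammer.
Variable K : fieldType.
Implicit Types (a q r v : K) (n : nat).

Lemma qpochS a q n : qpoch a q n.+1 = qpoch a q n * (1 - a * q ^+ n).
Proof. by rewrite /qpoch big_ord_recr. Qed.

Lemma qpochSl a q n : qpoch a q n.+1 = (1 - a) * qpoch (q * a) q n.
Proof.
rewrite /qpoch big_ord_recl expr0 mulr1; congr (_ * _).
by apply: eq_bigr => i _; rewrite /= /bump add1n exprS mulrCA mulrA.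
Qed.

(** The factors 1 - q^(2k+1) and 1 - q^(2k+2) are differences of squares, of
    1 and r q^k and of 1 and q^(k+1) respectively. *)
Lemma qpoch_double r n :
  let q := r ^+ 2 in
  qpoch q q (2 * n) =
  qpoch r q n * qpoch (- r) q n * (qpoch q q n * qpoch (- q) q n).
Proof.
move=> q; elim: n => [|n IHn]; first by rewrite /qpoch !big_ord0 !mulr1.
rewrite mulnS addSn add1n !qpochS {}IHn exprS [(2 * n)%N]mulnC exprM /q.
ring.
Qed.

(** By [qpoch_double] at n + 1, the denominators and one of the two factors
    (q;q)_(n+1) cancel, leaving (1 - q^(n+1)) (r;q)_(n+1) / (q;q)_(n+1), which is
    (1 - r) (q r;q)_n / (q;q)_n. The factor v^n, left over from
    binom(n+1,2) = binom(n,2) + n, is what scales the argument y of the series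
    1Phi0 to v y. *)
Lemma central_term_dbhs r v n :
  let q := r ^+ 2 in
  (forall m, qpoch q q m != 0) -> (forall m, qpoch (- r) q m != 0) ->
  (forall m, qpoch (- q) q m != 0) ->
  qbinom q (2 * n.+1) n.+1 * ((1 - q ^+ n.+1) * v ^+ 'C(n.+1, 2))
    / (qpoch (- r) q n.+1 * qpoch (- q) q n.+1)
  = (1 - r) * v ^+ n * dbhs_coef [:: q * r] [::] q v n.
Proof.
move=> q hq hr hnq; have := hq n.+1.
rewrite /dbhs_coef !big_seq1 subrr expr0z mulr1.
rewrite /qbinom mul2n -addnn addnK addnn -mul2n qpoch_double -/q (qpochSl r).
rewrite binS bin1 exprD.
move: (hq n) (hr n.+1) (hnq n.+1); rewrite (qpochS q q) -exprS => h0 h1 h2.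
(* The last factor of (q;q)_(n+1) <> 0 gives 1 - q^(n+1) <> 0, needed to cancel. *)
rewrite mulf_eq0 negb_or => /andP[_ h3].
by field; rewrite h0 h1 h2.
Qed.

End QPochhammer.

Lemma qpoch_neq0 (K : numFieldType) (a q : K) n :
  `|a| < 1 -> `|q| < 1 -> qpoch a q n != 0.
Proof.
move=> a1 q1; apply/prodf_neq0 => i _; rewrite subr_eq0.
apply/eqP => aq1; suff: `|a * q ^+ i| < 1 by rewrite -aq1 normr1 ltxx.
rewrite normrM normrX (le_lt_trans _ a1) //.
by rewrite ler_piMr // exprn_ile1 // ltW.
Qed.

Section FormalSeries.
Variable K : comNzRingType.
Implicit Types (c : K) (f : fps K) (m n : nat).

Lemma fps_coefXM f n :
  fps_coef (fpsX * f) n = if n is m.+1 then fps_coef f m else 0.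
Proof.
case: n => [|n] /=; first by rewrite big_ord1 mul0r.
rewrite !big_ord_recl /= mul0r add0r mul1r subn1 big1 ?addr0 // => i _.
by rewrite mul0r.
Qed.

Lemma fps_coefZXM c f n :
  fps_coef (c *: fpsX * f) n = if n is m.+1 then c * fps_coef f m else 0.
Proof.
rewrite -(scalerAl c) [LHS]/(c * fps_coef _ _) fps_coefXM.
by case: n => [|n]; first exact: mulr0.
Qed.

Lemma fps_coefXn m n : fps_coef (fpsX ^+ m : fps K) n = (n == m)%:R.
Proof.
elim: m n => [|m IHm] n; first by rewrite expr0 /=; case: eqP.
by rewrite exprS fps_coefXM; case: n.
Qed.

(** The k-th summand is the monomial b_k c^k X^k, so in degree n only k = n
    contributes, provided that it lies in the range of summation. *)
Lemma fps_coef_sum_monomial m (b : nat -> K) c n :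
  fps_coef (fps_sum m (fun k => b k *: (c *: fpsX) ^+ k)) n
    = if (m <= n)%N then b n * c ^+ n else 0.
Proof.
have coefE k :
    fps_coef (b k *: (c *: fpsX) ^+ k) n = b k * c ^+ k * (n == k)%:R.
  by rewrite exprZn scalerA /= fps_coefXn.
rewrite [LHS](eq_bigr _ (fun k _ => coefE k)).
case: leqP => [mn|nm]; last by rewrite big_geq.
rewrite big_nat_recr //= eqxx mulr1 big_nat big1 ?add0r // => k /andP[_ kn].
by rewrite gtn_eqF ?mulr0.
Qed.

End FormalSeries.

Lemma lim_shift_scale (K : numFieldType) (c : K) (f g : K ^nat) :
  (forall n, f n.+1 = c * g n) -> cvgn g -> limn f = c * limn g.
Proof.
move=> fS cvg_g; apply: cvg_lim; first exact: norm_hausdorff.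
rewrite -cvg_shiftS; under eq_fun do rewrite fS.
exact: cvgMr.
Qed.

(* d, sq, w are the fixed square roots of s^2 + 4t, q and - t phi. *)
Theorem theorem9 (R : realType) (s t u d q sq w : Cplx R)
    (ht : t != 0)
    (hd : d ^+ 2 = s ^+ 2 + 4 * t)
    (hq : q = phi' s d / phi s d)
    (hq0 : 0 < `|q|) (hq1 : `|q| < 1)
    (hsq : sq ^+ 2 = q)
    (hw : w ^+ 2 = - t * phi s d) :
  let a (n : nat) : Cplx R :=
    qbinom q (2 * n) n * ((1 - q ^+ n) * (- u / t) ^+ 'C(n, 2))
    / (qpoch (- sq) q n * qpoch (- q) q n) in
  fps_sum 1 (fun n => a n *: ((4 / w) *: fpsX) ^+ n)
    = ((4 * (1 - sq) / w) *: fpsX)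
      * fps_dbhs [:: q * sq] [::] q (- u / t) ((- 4 * u / (t * w)) *: fpsX)
  /\
  forall x : Cplx R,
    cvgn (fun N => \sum_(1 <= n < N) a n * (4 * x / w) ^+ n) ->
    cvgn (dbhs_psum [:: q * sq] [::] q (- u / t) (- 4 * u * x / (t * w))) ->
    limn (fun N => \sum_(1 <= n < N) a n * (4 * x / w) ^+ n)
      = (4 * (1 - sq) * x / w)
        * dbhs [:: q * sq] [::] q (- u / t) (- 4 * u * x / (t * w)).
Proof.
set v := - u / t => a.
have sq1 : `|sq| < 1 by rewrite -(@expr_lt1 _ 2) // -normrX hsq.
have aS n : a n.+1 = (1 - sq) * v ^+ n * dbhs_coef [:: q * sq] [::] q v n.
  rewrite /a -hsq; apply: central_term_dbhs => m; rewrite hsq;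
    by apply: qpoch_neq0; rewrite ?normrN.
have vyE n y : (1 - sq) * v ^+ n * dbhs_coef [:: q * sq] [::] q v n * y ^+ n.+1
    = (1 - sq) * y * (dbhs_coef [:: q * sq] [::] q v n * (v * y) ^+ n).
  by rewrite (exprMn _ v) exprS; ring.
split.
- have -> : - 4 * u / (t * w) = v * (4 / w) by rewrite /v invfM; ring.
  have -> : 4 * (1 - sq) / w = (1 - sq) * (4 / w) by ring.
  apply/fpsP => n; rewrite fps_coef_sum_monomial fps_coefZXM.
  case: n => [//|n].
  by rewrite /fps_dbhs fps_coef_sum_monomial ltn0Sn leq0n aS vyE.
- move=> x _.
  have -> : - 4 * u * x / (t * w) = v * (4 * x / w) by rewrite /v invfM; ring.
  have -> : 4 * (1 - sq) * x / w = (1 - sq) * (4 * x / w) by ring.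
  move=> cvg_dbhs; rewrite /dbhs.
  apply: lim_shift_scale cvg_dbhs => N.
  rewrite big_add1 /= mulr_sumr.
  by apply: eq_bigr => n _; rewrite aS vyE.
Qed.
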